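(* Consider the first-order quasi-linear system for $U=(U_1,U_2,U_3,U_4)^t=(\theta,\alpha,H,P)^t$ as functions of $(r,\phi)$, $r>0$: $$A(r,\phi,U)U_r+B(r,\phi,U)U_\phi+C(r,\phi,U)U=0,$$ with $s=\sin(\theta-\phi)$, $c=\cos(\theta-\phi)$ and $$A=\begin{pmatrix}\frac13sH+c\alpha& s&0&0\\ -c\alpha&s&0&0\\ 0&6s\alpha&-c\alpha&s\\ 2c\alpha^2&2s\alpha&-\frac23sH-c\alpha&-s\end{pmatrix},\quad B=\frac1r\begin{pmatrix}-\frac13cH+s\alpha&-c&0&0\\ -s\alpha&-c&0&0\\ 0&-6c\alpha&-s\alpha&-c\\ 2s\alpha^2&-2c\alpha&\frac23cH-s\alpha&c\end{pmatrix},$$ $$C=-\begin{pmatrix}0&-\alpha&0&0\\0&2\alpha&0&0\\0&4\alpha^2&\alpha H&0\\0&0&\alpha H&0\end{pmatrix}.$$ Let $U$ and $V$ be smooth solutions on a neighborhood of the curve $\{r=\mathbf{c}\}$, $\mathbf{c}>0$, such that $\det A(r,\phi,U)\neq0$ on this curve and $U(\mathbf{c},\phi)=V(\mathbf{c},\phi)$ for all $\phi$. Then $U=V$ on a neighborhood of the curve $r=\mathbf{c}$.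
   Context: This system is the one satisfied by $U=(\theta,\alpha,H,-N^\perp\alpha)$ for an absolute $E_1$-minimizing graph in the Heisenberg group, written in polar coordinates; one has $\det A=s^2(\frac13sH+2c\alpha)(\frac23sH+2c\alpha)$. *)

(* Defs.v *)
From HB Require Import structures.
From mathcomp Require Import all_boot all_order all_algebra.
From mathcomp Require Import all_classical all_reals all_analysis.
Set Implicit Arguments. Unset Strict Implicit. Unset Printing Implicit Defensive.
Import Order.TTheory GRing.Theory Num.Theory.
Import numFieldNormedType.Exports.
Local Open Scope classical_set_scope.
Local Open Scope ring_scope.

Section Defs.
Variable R : realType.

Definition partial_r (f : R -> R -> R) : R -> R -> R :=
  fun r p => derive1 (fun t => f t p) r.
Definition partial_phi (f : R -> R -> R) : R -> R -> R :=
  fun r p => derive1 (fun t => f r t) p.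

Fixpoint Ck (n : nat) (W : set (R * R)) (f : R -> R -> R) : Prop :=
  match n with
  | 0%N => {within W, continuous (fun z : R * R => f z.1 z.2)}
  | n'.+1 =>
      (forall r p, W (r, p) ->
         derivable (fun t => f t p) r 1 /\ derivable (fun t => f r t) p 1)
      /\ Ck n' W (partial_r f) /\ Ck n' W (partial_phi f)
  end.

Definition smooth_on (W : set (R * R)) (f : R -> R -> R) : Prop :=
  forall n, Ck n W f.

Definition comp (u : 'cV[R]_4) (k : nat) : R := u (inord k) ord0.

Definition smoothV (W : set (R * R)) (U : R -> R -> 'cV[R]_4) : Prop :=
  forall i : 'I_4, smooth_on W (fun r p => U r p i ord0).

Definition mx4 (a : seq (seq R)) : 'M[R]_4 :=
  \matrix_(i < 4, j < 4) nth 0 (nth [::] a i) j.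

Definition Amat (r phi : R) (u : 'cV[R]_4) : 'M[R]_4 :=
  let th := comp u 0 in let al := comp u 1 in let H := comp u 2 in
  let s := sin (th - phi) in let c := cos (th - phi) in
  mx4 [:: [:: 3^-1 * s * H + c * al; s; 0; 0];
          [:: - (c * al); s; 0; 0];
          [:: 0; 6 * s * al; - (c * al); s];
          [:: 2 * c * al ^+ 2; 2 * s * al; - (2 / 3 * s * H + c * al); - s]].

Definition Bmat (r phi : R) (u : 'cV[R]_4) : 'M[R]_4 :=
  let th := comp u 0 in let al := comp u 1 in let H := comp u 2 in
  let s := sin (th - phi) in let c := cos (th - phi) in
  r^-1 *: mx4 [:: [:: - (3^-1 * c * H) + s * al; - c; 0; 0];
                  [:: - (s * al); - c; 0; 0];
                  [:: 0; - (6 * c * al); - (s * al); - c];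
                  [:: 2 * s * al ^+ 2; - (2 * c * al); 2 / 3 * c * H - s * al; c]].

Definition Cmat (r phi : R) (u : 'cV[R]_4) : 'M[R]_4 :=
  let al := comp u 1 in let H := comp u 2 in
  - mx4 [:: [:: 0; - al; 0; 0];
            [:: 0; 2 * al; 0; 0];
            [:: 0; 4 * al ^+ 2; al * H; 0];
            [:: 0; 0; al * H; 0]].

Definition dU_r (U : R -> R -> 'cV[R]_4) (r p : R) : 'cV[R]_4 :=
  \col_i partial_r (fun r' p' => U r' p' i ord0) r p.
Definition dU_phi (U : R -> R -> 'cV[R]_4) (r p : R) : 'cV[R]_4 :=
  \col_i partial_phi (fun r' p' => U r' p' i ord0) r p.

Definition solves (W : set (R * R)) (U : R -> R -> 'cV[R]_4) : Prop :=
  forall r p, W (r, p) ->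
    Amat r p (U r p) *m dU_r U r p + Bmat r p (U r p) *m dU_phi U r p
    + Cmat r p (U r p) *m U r p = 0.

End Defs.

(* Main.v *)
Require Import Defs.
From HB Require Import structures.
From mathcomp Require Import all_boot all_order all_algebra.
From mathcomp Require Import ring lra.
From mathcomp Require Import all_classical all_reals all_analysis.
Import Order.TTheory GRing.Theory Num.Theory.
Import numFieldNormedType.Exports.
Local Open Scope classical_set_scope.
Local Open Scope ring_scope.

(** Left multiplication by a smooth matrix brings the system to Riemann form:
    with [S = s d_r - (c/r) d_phi], [C = c d_r + (s/r) d_phi] and the vector
    fields [T1 = (H/3) S + 2 alpha C], [T2 = (2H/3) S + 2 alpha C], it says
<<
      T1 theta                        = - 3 alpha^2
      S alpha + (H/6) S theta         = alpha^2 / 2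
      T2 H + 5 alpha T2 theta         = - 18 alpha^3 - 2 alpha H^2
      S P + alpha S alpha + (H/3) S H = 0
>>
    so that row [i] differentiates along one vector field only, with a
    unitriangular coefficient matrix [N(U)]; no strict hyperbolicity is needed.
    As [det A <> 0] on the curve, the [r]-components of the three fields do
    not vanish there.  Hence [z = N(U) (U - V)] satisfies
    [|d_r z_i + l_i d_phi z_i| <= K sum_j |z_j|] with bounded slopes [l_i] and
    [z = 0] on [r = c].  A maximum principle on a small cone then gives [z = 0]:
    at a maximum of [z_i^2 (2 delta - |r - c|)], moving towards the curve along
    the [i]-th characteristic direction does not leave the cone but increases
    the function. *)

(** * Derivatives in one variable and along lines in the plane *)

(** Clearing the denominator of the difference quotient gives an estimate that also holds at
    [h = 0], so no punctured neighborhood is needed below. *)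
Lemma is_derive1P (R : realType) (f : R -> R) (x d : R) :
  is_derive x 1 f d <->
  (forall e : R, 0 < e ->
     \forall h \near (0 : R), `|f (x + h) - f x - d * h| <= e * `|h|).
Proof.
have quo (h : R) : h != 0 ->
    `|h^-1 *: (f (h *: 1 + x) - f x) - d| * `|h|
    = `|f (x + h) - f x - d * h|.
  by move=> h0; rewrite -normrM; congr `|_|; rewrite /GRing.scale /= mulr1
    (addrC h); field.
split=> [[fx fd] e e0|H].
  have : h^-1 *: (f (h *: 1 + x) - f x) @[h --> 0^'] --> d.
    by rewrite -fd; apply: fx.
  move=> /cvgrPdist_le/(_ _ e0); rewrite near_withinE => K.
  near=> h; have [->|h0] := eqVneq h 0.
    by rewrite addr0 mulr0 subrr subr0 normr0 mulr0.
  by rewrite -quo// ler_wpM2r// distrC; move: h0; near: h.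
have : h^-1 *: (f (h *: 1 + x) - f x) @[h --> 0^'] --> d.
  apply/cvgrPdist_le => e e0; rewrite near_withinE; near=> h => h0.
  rewrite distrC -(ler_pM2r (_ : 0 < `|h|)) ?normr_gt0// quo//.
  by near: h; exact: H.
move=> K; split; last exact: cvg_lim K.
by apply/cvg_ex; exists d.
Unshelve. all: by end_near. Qed.

(** Locating the intermediate point by its distance to [x] covers increments of both signs at
    once. *)
Lemma MVT_dist (R : realType) (f df : R -> R) (x h : R) :
  (forall y, `|y - x| <= `|h| -> is_derive y 1 f (df y)) ->
  exists2 y, `|y - x| <= `|h| & f (x + h) - f x = df y * h.
Proof.
move=> fdf.
have cf (a b : R) : (forall y, y \in `[a, b] -> `|y - x| <= `|h|) ->
    {within `[a, b], continuous f}.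
  move=> ab; apply: derivable_within_continuous => y /ab yab.
  by have [] := fdf _ yab.
have [h0|h0] := leP 0 h.
  have I y : y \in `[x, x + h] -> `|y - x| <= `|h|.
    by rewrite in_itv/= ler_distl ger0_norm// => /andP[? ?]; lra.
  have [||y yI e] := @MVT_segment _ f df x (x + h) _ _ (cf _ _ I); first by lra.
    by move=> y /subset_itv_oo_cc /I /fdf.
  by exists y; [exact: I|rewrite e; congr (_ * _); ring].
have I y : y \in `[x + h, x] -> `|y - x| <= `|h|.
  by rewrite in_itv/= ler_distl ltr0_norm// => /andP[? ?]; lra.
have [||y yI e] := @MVT_segment _ f df (x + h) x _ _ (cf _ _ I); first by lra.
  by move=> y /subset_itv_oo_cc /I /fdf.
by exists y; [exact: I|rewrite -opprB e; ring].
Qed.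

(** The partial derivatives are explicit functions on the plane, so that their joint continuity at
    [q] can be required. *)
Definition C1_at (R : realType) (f fr fp : R * R -> R) (q : R * R) : Prop :=
  [/\ {for q, continuous f},
      is_derive q.1 1 (fun t : R => f (t, q.2)) (fr q) /\
        {for q, continuous fr} &
      is_derive q.2 1 (fun t : R => f (q.1, t)) (fp q) /\
        {for q, continuous fp}].

Arguments C1_at {R}.

(** The increment is split at [(r, p + l * t)]. The part in the second variable is a one-variable
    chain rule; the part in the first is handled by the mean value theorem and the continuity of
    [fr]. *)
Lemma is_derive_line (R : realType) (f fr fp : R * R -> R) (q : R * R) (l : R) :
  (\forall x \near q, C1_at f fr fp x) ->
  is_derive (0 : R) 1 (fun t => f (q.1 + t, q.2 + l * t)) (fr q + l * fp q).
Proof.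
case: q => r p /= Cf.
have [_ [_ cfr] [dfp _]] := nbhs_singleton Cf.
have d2 : is_derive (0 : R) 1 (fun t => f (r, p + l * t)) (l * fp (r, p)).
  have dl : is_derive (0 : R) 1 (fun t => p + l * t) l.
    by apply: is_derive_eq; rewrite add0r mul1r [_ *: _]mulr1.
  have dfp' : is_derive (p + l * 0) 1 (fun t => f (r, t)) (fp (r, p)).
    by rewrite mulr0 addr0.
  have := @is_derive1_comp R (fun t => f (r, t)) (fun t => p + l * t) 0 _ _ dfp' dl.
  by rewrite mulrC.
suff d1 : is_derive (0 : R) 1
    (fun t => f (r + t, p + l * t) - f (r, p + l * t)) (fr (r, p)).
  have := is_deriveD d1 d2; congr is_derive.
  by apply/funext => t /=; rewrite subrK.
apply/is_derive1P => e e0.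
have /cvgrPdist_le/(_ _ e0) cfr' := cfr.
have /nbhs_ballP[d /= d0 bd] :
  \forall z \near (r, p), C1_at f fr fp z /\ `|fr (r, p) - fr z| <= e.
  by near=> z; split; near: z.
have hd : \forall h \near (0 : R), `|h| < d.
  by apply: (@nbhs0_lt _ _ d).
(* This bound gives [|l * h| < d]; the added 1 covers [l = 0]. *)
have hd2 : \forall h \near (0 : R), `|h| < d / (`|l| + 1).
  by apply: nbhs0_lt; rewrite divr_gt0// ltr_pwDr.
near=> h.
have h1 : `|h| < d by near: h.
have h2 : `|l * h| < d.
  have : `|h| < d / (`|l| + 1) by near: h.
  rewrite ltr_pdivlMr ?ltr_pwDr// normrM; apply: le_lt_trans.
  by rewrite mulrC ler_wpM2l// lerDl.
have B y : `|y - r| <= `|h| -> ball (r, p) d (y, p + l * h).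
  move=> yr; split => /=; rewrite /ball/=.
    by rewrite distrC (le_lt_trans yr).
  by rewrite opprD addrA subrr sub0r normrN.
have [|y /B /bd[_ /= yr] E] := @MVT_dist _ (fun y => f (y, p + l * h))
    (fun y => fr (y, p + l * h)) r h.
  by move=> y /B /bd[[_ []]].
rewrite add0r addr0 mulr0 addr0 subrr subr0 E -mulrBl normrM.
by rewrite ler_wpM2r// distrC.
Unshelve. all: by end_near. Qed.

(** * Maximum principle for transport inequalities on a cone *)

(** The maximum may lie on the boundary of the cone, where only displacements towards the curve are
    admissible, hence the one-sided form. If [s * d < 0], an error of at most half the linear term
    still makes [k] increase along [- s]. *)
Lemma is_derive_max_side (R : realType) (k : R -> R) (d s x : R) :
  is_derive x 1 k d -> `|s| = 1 ->
  (\forall e \near (0 : R)^'+, k (x - s * e) <= k x) -> 0 <= s * d.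
Proof.
move=> /is_derive1P dk s1 nk; rewrite leNgt; apply/negP => sd.
have e0 : 0 < - (s * d) / 2 by lra.
have := dk _ e0 => -[/= b b0 bd].
near (0 : R)^'+ => t.
have t0 : 0 < t by near: t; exact: nbhs_right_gt.
have := bd (- (s * t)).
rewrite /= sub0r opprK normrM s1 mul1r normrN normrM s1 mul1r gtr0_norm//.
have tb : t < b by near: t; exact: nbhs_right_lt.
move=> /(_ tb)/ler_normlP[+ _].
have : k (x - s * t) <= k x by near: t.
have : 0 < t * - (s * d) by rewrite mulr_gt0 ?oppr_gt0.
lra.
Unshelve. all: by end_near. Qed.

(** The slope [l] and the derivative [d] may depend on the point and on the component without any
    continuity: only their values at one maximum point are used. *)
Lemma transport_uniq (R : realType) (I : finType) (z : I -> R * R -> R)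
    (c p0 L K : R) :
  (\forall q \near (c, p0), forall i, {for q, continuous (z i)}) ->
  (\forall p \near p0, forall i, z i (c, p) = 0) ->
  (\forall q \near (c, p0), forall i, exists l d : R, [/\ `|l| <= L,
     is_derive (0 : R) 1 (fun t => z i (q.1 + t, q.2 + l * t)) d &
     `|d| <= K * \sum_j `|z j q|]) ->
  \forall q \near (c, p0), forall i, z i q = 0.
Proof.
move=> cz z0 Tz.
have [i0|I0] := pickP (@predT I); last by near=> q => i; have := I0 i.
move=> _.
have /nbhs_ballP[rho /= rho0 brho] : \forall q \near (c, p0), [/\
    forall i, {for q, continuous (z i)}, forall i, z i (c, q.2) = 0 &
    forall i, exists l d : R, [/\ `|l| <= L,
     is_derive (0 : R) 1 (fun t => z i (q.1 + t, q.2 + l * t)) d &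
     `|d| <= K * \sum_j `|z j q|]].
  have z0' : \forall q \near (c, p0), forall i, z i (c, q.2) = 0.
    exact: (cvg_snd z0).
  by near=> q; split; near: q.
(* At the maximum point [|z_i|] dominates every [|z_j|], so [|d|] is at most [k * |z_i|]. The number
   [N] bounds the slopes and sets the opening of the cone. *)
pose k : R := `|K| * #|I|%:R.
pose N : R := `|L| + 1.
have k0 : 0 <= k by rewrite /k mulr_ge0.
have N1 : 1 <= N by rewrite /N lerDr.
(* The first bound keeps the cone inside the ball where the hypotheses hold; the second gives
   [4 * k * dl < 1], which makes the final inequality strict. *)
pose dl := Num.min (rho / 2) (4 * (k + 1))^-1.
have dl0 : 0 < dl by rewrite lt_min divr_gt0//= invr_gt0; lra.
have dlrho : dl < rho.
  by apply: le_lt_trans (_ : rho / 2 < _); [rewrite ge_min lexx|lra].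
have dlk : 4 * k * dl < 1.
  have : dl <= (4 * (k + 1))^-1 by rewrite ge_min lexx orbT.
  rewrite -[X in _ <= X]div1r ler_pdivlMr; last lra.
  lra.
(* A step of length [e] towards the curve with slope [l] adds at most [|l| * e <= N * e] to the
   first term and removes [N * e] from the second, so it stays in [D]. *)
pose D := [set q : R * R | `|q.2 - p0| + N * `|q.1 - c| <= dl].
have D1 q : D q -> `|q.1 - c| <= dl.
  move=> Dq; apply: le_trans Dq; rewrite (le_trans (ler_peMl _ N1))//.
  by rewrite lerDr.
have D2 q : D q -> `|q.2 - p0| <= dl.
  by move=> Dq; apply: le_trans Dq; rewrite lerDl mulr_ge0//; lra.
have Dball q : D q -> ball (c, p0) rho q.
  by move=> Dq; split; rewrite /ball/= distrC;
     apply: le_lt_trans dlrho; [exact: D1|exact: D2].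
have Dnbhs : \forall q \near (c, p0), D q.
  have h : 0 < dl / (2 * N) by rewrite divr_gt0//; lra.
  exists (ball (c : R) (dl / (2 * N)), ball p0 (dl / (2 * N))) => /=.
    by split; exact: nbhsx_ballx.
  move=> -[r p] [/=]; rewrite /ball/= /D/= !ltr_pdivlMr; [|lra|lra].
  rewrite ![`|_ - r|]distrC ![`|_ - p|]distrC => rd pd.
  have : `|p - p0| <= `|p - p0| * N by rewrite ler_peMr.
  lra.
have Dc : compact D.
  apply: (@subclosed_compact _ _ (`[c - dl, c + dl] `*` `[p0 - dl, p0 + dl])).
  - have cD : continuous (fun q : R * R => `|q.2 - p0| + N * `|q.1 - c|).
      move=> q; apply: cvgD.
        by apply: cvg_norm; apply: cvgB; [exact: cvg_snd|exact: cvg_cst].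
      apply: cvgMr; apply: cvg_norm; apply: cvgB; [exact: cvg_fst|exact: cvg_cst].
    by apply: (closed_comp _ (@closed_le R dl)) => q _; exact: cD.
  - by apply: compact_setX; exact: segment_compact.
  - move=> q Dq; split; rewrite /= in_itv/= -ler_distl; [exact: D1|exact: D2].
(* On [D] the weight lies between [dl] and [2 * dl], and it grows at unit rate towards the curve. *)
pose g i (q : R * R) := z i q ^+ 2 * (2 * dl - `|q.1 - c|).
have /choice[m mP] : forall i, exists q, D q /\ forall t, D t -> g i t <= g i q.
  move=> i; have [||q] := @compact_EVT_max _ R (g i) D _ Dc.
  - by exists (c, p0); exact: nbhs_singleton.
  - apply: continuous_in_subspaceT => q /set_mem /Dball /brho[/(_ i) zi _ _].
    apply: cvgM; first by rewrite expr2; apply: cvgM.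
    apply: cvgB; first exact: cvg_cst.
    by apply: cvg_norm; apply: cvgB; [exact: cvg_fst|exact: cvg_cst].
  - by move=> /set_mem Dq qmax; exists q; split=> // t Dt; apply/qmax/mem_set.
(* Maximizing over the components as well as over [D] lets [z_i] control all the [z_j] at the
   maximum point. *)
pose i := [arg max_(i > i0) g i (m i)]%O.
have mi j t : D t -> g j t <= g i (m i).
  move=> Dt; rewrite /i; case: arg_maxP => // i' _ /(_ j isT) le_m.
  by apply: le_trans le_m; have [_ ->] := mP j.
have [Dq _] := mP i; move: Dq mi; move: (m i) => q Dq mi.
have w0 t : D t -> 0 < 2 * dl - `|t.1 - c| by move/D1; lra.
have [gle|ggt] := leP (g i q) 0.
  near=> t => j; have Dt : D t by near: t.
  have := le_trans (mi j t Dt) gle.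
  by rewrite /g pmulr_lle0 ?w0// expr2 -expr2 => h;
    apply/eqP; rewrite -sqrf_eq0 eq_le h sqr_ge0.
exfalso.
have zq0 : 0 < z i q ^+ 2 by move: ggt; rewrite /g pmulr_lgt0// w0.
have zj j : `|z j q| <= `|z i q|.
  have := mi j q Dq; rewrite /g ler_pM2r ?w0// => h.
  by rewrite -ler_sqr ?nnegrE// !real_normK ?num_real.
have [_ zc /(_ i)[l [d [lL dz dle]]]] := brho _ (Dball _ Dq).
have qc : q.1 != c.
  by apply/eqP => qc; move: zq0; rewrite (surjective_pairing q) qc zc expr0n ltxx.
(* On the side of the curve that contains the maximum point, [|r - c|] is the differentiable
   function [s * (r - c)]. *)
pose s := Num.sg (q.1 - c).
have s1 : `|s| = 1 by rewrite normr_sg subr_eq0 qc.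
have ss : s * s = 1 by rewrite -expr2 sqr_sg subr_eq0 qc.
have sN : `|q.1 - c| = s * (q.1 - c) by rewrite normrEsg.
pose w := 2 * dl - `|q.1 - c|.
have dk : is_derive (0 : R) 1
    (fun t => z i (q.1 + t, q.2 + l * t) ^+ 2 * (2 * dl - s * (q.1 + t - c)))
    (2 * z i q * d * w - s * z i q ^+ 2).
  have dz2 := is_deriveM dz dz.
  have dw : is_derive (0 : R) 1 (fun t => 2 * dl - s * (q.1 + t - c)) (- s).
    by apply: is_derive_eq; rewrite add0r mul1r subr0 [_ *: _]mulr1.
  have zq : z i (q.1 + 0, q.2 + l * 0) = z i q.
    by rewrite addr0 mulr0 addr0 -surjective_pairing.
  apply: is_derive_eq (is_deriveM dz2 dw) _.
  rewrite (_ : (_ * _) 0 = z i q ^+ 2); last by rewrite -zq.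
  by rewrite zq addr0 -sN -/w /GRing.scale/=; ring.
have sd := is_derive_max_side _ _ _ _ _ dk s1.
have /sd : \forall e \near 0^'+,
    z i (q.1 + (0 - s * e), q.2 + l * (0 - s * e)) ^+ 2 *
      (2 * dl - s * (q.1 + (0 - s * e) - c)) <=
    z i (q.1 + 0, q.2 + l * 0) ^+ 2 * (2 * dl - s * (q.1 + 0 - c)).
  near=> e.
  have e0 : 0 < e by near: e; exact: nbhs_right_gt.
  (* The step must not cross the curve. *)
  have ec : e <= `|q.1 - c|.
    by near: e; apply: nbhs_right_le; rewrite normr_gt0 subr_eq0.
  have te : `|q.1 + (0 - s * e) - c| = `|q.1 - c| - e.
    have -> : q.1 + (0 - s * e) - c = s * (`|q.1 - c| - e).
      by rewrite mulrBr sN mulrA ss; ring.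
    by rewrite normrM s1 mul1r ger0_norm// subr_ge0.
  have Dt : D (q.1 + (0 - s * e), q.2 + l * (0 - s * e)).
    rewrite /D/= te.
    have : `|q.2 + l * (0 - s * e) - p0| <= `|q.2 - p0| + `|l| * e.
      rewrite sub0r addrAC (le_trans (ler_normD _ _))// lerD2l.
      by rewrite normrM normrN normrM s1 mul1r (gtr0_norm e0).
    have : `|l| * e <= N * e.
      by rewrite ler_wpM2r ?(ltW e0)// (le_trans lL)// (le_trans (ler_norm L))// lerDl.
    by move: Dq; rewrite /D/= mulrBr; lra.
  have := mi i _ Dt; rewrite /g/= te.
  have -> : s * (q.1 + (0 - s * e) - c) = `|q.1 - c| - e.
    by rewrite sN -[X in _ = _ - X]mul1r -ss; ring.
  by rewrite !addr0 mulr0 addr0 -sN -surjective_pairing.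
(* The contradiction: [s] times the derivative is at most [(4 * k * dl - 1) * z_i^2], which is
   negative. *)
apply/negP; rewrite -ltNge.
have -> : s * (2 * z i q * d * w - s * z i q ^+ 2)
    = 2 * (s * z i q * d) * w - z i q ^+ 2.
  by rewrite -[in RHS](mul1r (z i q ^+ 2)) -ss; ring.
have dk' : `|d| <= k * `|z i q|.
  apply: (le_trans dle); apply: (le_trans (_ : _ <= `|K| * \sum_j `|z j q|)).
    by rewrite ler_wpM2r ?ler_norm// sumr_ge0.
  rewrite /k -mulrA ler_wpM2l//.
  apply: (le_trans (ler_sum _ (fun j _ => zj j))).
  by rewrite sumr_const mulr_natl.
have a1 : s * z i q * d <= k * z i q ^+ 2.
  apply: (le_trans (ler_norm _)); rewrite !normrM s1 mul1r.
  rewrite -[z i q ^+ 2]real_normK ?num_real// expr2 mulrCA.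
  exact: ler_wpM2l.
have w2 : 0 < w <= 2 * dl by rewrite w0//= gerBl.
have a2 : s * z i q * d * w <= k * z i q ^+ 2 * (2 * dl).
  case/andP: w2 => wp wl; apply: (@le_trans _ _ (k * z i q ^+ 2 * w)).
    by rewrite ler_wpM2r// ltW.
  by rewrite ler_wpM2l// mulr_ge0// ltW.
have a3 : (4 * k * dl) * z i q ^+ 2 < z i q ^+ 2 by rewrite gtr_pMl.
lra.
Unshelve. all: by end_near. Qed.

(** * Calculus of O-estimates near a point *)

(* [f = O(M)] near [q0]; [M = fun=> 1] means that [f] is bounded near [q0]. *)
Definition ldom (R : realType) (q0 : R * R) (M f : R * R -> R) : Prop :=
  exists2 K : R, 0 <= K & \forall q \near q0, `|f q| <= K * M q.

Arguments ldom {R}.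

Section ldom.
Variables (R : realType) (q0 : R * R).
Implicit Types M f g : R * R -> R.

Lemma ldom_near M f g :
  (\forall q \near q0, f q = g q) -> ldom q0 M g -> ldom q0 M f.
Proof.
move=> fg [K K0 gK]; exists K => //; near=> q.
have -> : f q = g q by near: q; exact: fg.
by near: q.
Unshelve. all: by end_near. Qed.

Lemma ldomD M f g :
  ldom q0 M f -> ldom q0 M g -> ldom q0 M (fun q => f q + g q).
Proof.
move=> [K K0 fK] [L L0 gL]; exists (K + L); first exact: addr_ge0.
near=> q; rewrite mulrDl (le_trans (ler_normD _ _))// lerD//; by near: q.
Unshelve. all: by end_near. Qed.

Lemma ldomN M f : ldom q0 M f -> ldom q0 M (fun q => - f q).
Proof. by move=> [K K0 fK]; exists K => //; apply: filterS fK => q; rewrite normrN.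
Qed.

Lemma ldomB M f g :
  ldom q0 M f -> ldom q0 M g -> ldom q0 M (fun q => f q - g q).
Proof. by move=> Mf Mg; apply: ldomD => //; exact: ldomN. Qed.

Lemma ldomM M f g :
  ldom q0 (fun=> 1) f -> ldom q0 M g -> ldom q0 M (fun q => f q * g q).
Proof.
move=> [K K0 fK] [L L0 gL]; exists (K * L); first exact: mulr_ge0.
near=> q; rewrite normrM -mulrA ler_pM//; last by near: q.
by rewrite -[K]mulr1; near: q.
Unshelve. all: by end_near. Qed.

Lemma ldom_trans M N f : ldom q0 N f -> ldom q0 M N -> ldom q0 M f.
Proof.
move=> [K K0 fK] [L L0 NL]; exists (K * L); first exact: mulr_ge0.
near=> q; apply: (@le_trans _ _ (K * N q)); first by near: q.
rewrite -mulrA ler_wpM2l// (le_trans (ler_norm _))//; by near: q.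
Unshelve. all: by end_near. Qed.

Lemma ldom0 M : ldom q0 M (fun=> 0).
Proof. by exists 0 => //; near=> q; rewrite normr0 mul0r.
Unshelve. all: by end_near. Qed.

Lemma ldom_sum M (I : Type) (s : seq I) (f : I -> R * R -> R) :
  (forall i, ldom q0 M (f i)) -> ldom q0 M (fun q => \sum_(i <- s) f i q).
Proof.
move=> Mf; elim: s => [|i s IH].
  by apply: ldom_near (ldom0 M); near=> q; rewrite big_nil.
by apply: ldom_near (ldomD _ _ _ (Mf i) IH); near=> q; rewrite big_cons.
Unshelve. all: by end_near. Qed.

Lemma ldom_norm M f : ldom q0 M f -> ldom q0 M (fun q => `|f q|).
Proof. by move=> [K K0 fK]; exists K => //; apply: filterS fK => q; rewrite normr_id.
Qed.

Lemma ldom_cont f : {for q0, continuous f} -> ldom q0 (fun=> 1) f.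
Proof.
move=> /cvg_bounded/(@ex_strict_bound_gt0 _ _ _ _ _ _)[K K0 fK].
exists K; first exact: ltW.
by near=> q; rewrite mulr1 ltW//; near: q.
Unshelve. all: by end_near. Qed.

Lemma ldom_cst (k : R) : ldom q0 (fun=> 1) (fun=> k).
Proof. by apply: ldom_cont; exact: cvg_cst. Qed.

(** As [f g - f' g' = f (g - g') + g' (f - f')], only one factor of each product has to be
    bounded. *)
Lemma ldom_mulB M f f' g g' :
  ldom q0 (fun=> 1) f -> ldom q0 (fun=> 1) g' ->
  ldom q0 M (fun q => f q - f' q) -> ldom q0 M (fun q => g q - g' q) ->
  ldom q0 M (fun q => f q * g q - f' q * g' q).
Proof.
move=> f1 g1 ff gg.
apply: ldom_near (ldomD _ _ _ (ldomM _ _ _ f1 gg) (ldomM _ _ _ g1 ff)).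
by near=> q; ring.
Unshelve. all: by end_near. Qed.

Lemma ldom_addB M f f' g g' :
  ldom q0 M (fun q => f q - f' q) -> ldom q0 M (fun q => g q - g' q) ->
  ldom q0 M (fun q => (f q + g q) - (f' q + g' q)).
Proof.
by move=> ff gg; apply: ldom_near (ldomD _ _ _ ff gg); near=> q; ring.
Unshelve. all: by end_near. Qed.

Lemma ldom_oppB M f f' :
  ldom q0 M (fun q => f q - f' q) ->
  ldom q0 M (fun q => - f q - - f' q).
Proof.
by move=> ff; apply: ldom_near (ldomN _ _ ff); near=> q; ring.
Unshelve. all: by end_near. Qed.

Lemma ldom_reflB M f : ldom q0 M (fun q => f q - f q).
Proof. by apply: ldom_near (ldom0 M); near=> q; rewrite subrr.
Unshelve. all: by end_near. Qed.

End ldom.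

(** * Uniqueness for systems in Riemann form *)

(* The coefficients [t, m, F, N] are those of the system along the solution [a],
   and the primed ones those along [b], so that they are only assumed to differ
   by [O(|a - b|)]. *)
Lemma riemann_uniq (R : realType) (n : nat) (c p0 : R)
    (a ar ap b br bp : 'I_n -> R * R -> R)
    (N Nr Np N' : 'I_n -> 'I_n -> R * R -> R)
    (t t' m m' F F' : 'I_n -> R * R -> R) :
  let q0 := (c, p0) in
  let w j q := a j q - b j q in
  let z i q := \sum_j N i j q * w j q in
  let W q := \sum_j `|w j q| in
  (\forall q \near q0, forall i, C1_at (a i) (ar i) (ap i) q) ->
  (\forall q \near q0, forall i, C1_at (b i) (br i) (bp i) q) ->
  (\forall q \near q0, forall i j, C1_at (N i j) (Nr i j) (Np i j) q) ->
  (forall i, {for q0, continuous (t i)}) ->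
  (forall i, {for q0, continuous (m i)}) ->
  (forall i, t i q0 != 0) ->
  (forall i, ldom q0 W (fun q => t i q - t' i q)) ->
  (forall i, ldom q0 W (fun q => m i q - m' i q)) ->
  (forall i, ldom q0 W (fun q => F i q - F' i q)) ->
  (forall i j, ldom q0 W (fun q => N i j q - N' i j q)) ->
  (forall j, ldom q0 (fun q => \sum_i `|z i q|) (w j)) ->
  (\forall q \near q0, forall i,
     \sum_j N i j q * (t i q * ar j q + m i q * ap j q) = F i q) ->
  (\forall q \near q0, forall i,
     \sum_j N' i j q * (t' i q * br j q + m' i q * bp j q) = F' i q) ->
  (\forall p \near p0, forall i, a i (c, p) = b i (c, p)) ->
  \forall q \near q0, forall i, a i q = b i q.
Proof.
move=> q0 w z W Ca Cb CN ct cm t0 tt mm FF NN wz Ea Eb ab0.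
have W1 : ldom q0 (fun=> 1) W.
  apply: ldom_sum => i; apply: ldom_norm; apply: ldomB; apply: ldom_cont.
    by have [] := nbhs_singleton Ca i.
  by have [] := nbhs_singleton Cb i.
have ct1 i : ldom q0 (fun=> 1) (fun q => (t i q)^-1).
  by apply: ldom_cont; apply: cvgV => //; exact: ct.
(* Dividing row [i] by [t i] turns its vector field into [d_r + l d_phi]. *)
pose l i q := m i q * (t i q)^-1.
have l1 i : ldom q0 (fun=> 1) (l i).
  by apply: ldomM => //; apply: ldom_cont; exact: cm.
pose d i q := \sum_j ((Nr i j q + l i q * Np i j q) * w j q +
  N i j q * ((ar j q + l i q * ap j q) - (br j q + l i q * bp j q))).
have dz : \forall q \near q0, forall i,
    is_derive (0 : R) 1 (fun s => z i (q.1 + s, q.2 + l i q * s)) (d i q).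
  have := near_join Ca; have := near_join Cb; have := near_join CN.
  move=> nN nb na; near=> q => i.
  have hN j : \forall x \near q, C1_at (N i j) (Nr i j) (Np i j) x.
    have : \forall x \near q, forall i j, C1_at (N i j) (Nr i j) (Np i j) x.
      by near: q.
    by apply: filterS => x.
  have ha j : \forall x \near q, C1_at (a j) (ar j) (ap j) x.
    have : \forall x \near q, forall j, C1_at (a j) (ar j) (ap j) x by near: q.
    by apply: filterS => x.
  have hb j : \forall x \near q, C1_at (b j) (br j) (bp j) x.
    have : \forall x \near q, forall j, C1_at (b j) (br j) (bp j) x by near: q.
    by apply: filterS => x.
  have D j := is_deriveM (is_derive_line _ _ _ _ _ (l i q) (hN j))
    (is_deriveB (is_derive_line _ _ _ _ _ (l i q) (ha j))
                (is_derive_line _ _ _ _ _ (l i q) (hb j))).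
  have := is_derive_sum D; rewrite fct_sumE.
  move/is_derive_eq; apply; apply: eq_bigr => j _.
  have e : (q.1 + 0, q.2 + l i q * 0) = q.
    by rewrite mulr0 !addr0 -surjective_pairing.
  rewrite e /GRing.scale/= addrC mulrC; congr (_ * _ + _).
  by rewrite /w -[in RHS]e.
have tn0 : \forall q \near q0, forall i, t i q != 0.
  apply: (@filter_forall _ _ (fun i q => t i q != 0) (nbhs q0) _) => i.
  by exact: cvgr_neq0 (ct i) (t0 i).
have dW i : ldom q0 W (d i).
  have NC j := nbhs_singleton CN i j.
  have bC j := nbhs_singleton Cb j.
  (* Subtracting the two equations removes the derivatives of [a]: what remains is [F - F'] and
     differences of coefficients applied to the bounded derivatives of [b]. *)
  apply: (@ldom_near _ _ _ _ (fun q =>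
    \sum_j (Nr i j q + l i q * Np i j q) * w j q +
    (t i q)^-1 * ((F i q - F' i q) -
      \sum_j (N i j q * (t i q * br j q + m i q * bp j q) -
              N' i j q * (t' i q * br j q + m' i q * bp j q))))).
    near=> q; rewrite /d big_split/=; congr (_ + _).
    have <- : \sum_j N i j q * (t i q * ar j q + m i q * ap j q) = F i q.
      by near: q; apply: filterS Ea.
    have <- : \sum_j N' i j q * (t' i q * br j q + m' i q * bp j q) = F' i q.
      by near: q; apply: filterS Eb.
    have tq : t i q != 0 by near: q; apply: filterS tn0.
    rewrite -!sumrB mulr_sumr; apply: eq_bigr => j _; rewrite /l.
    by field.
  have wW j : ldom q0 W (w j).
    exists 1 => //; near=> q; rewrite mul1r /W (bigD1 j)//= lerDl.
    by apply: sumr_ge0.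
  apply: ldomD.
    apply: ldom_sum => j; apply: ldomM => //; apply: ldomD.
      by apply: ldom_cont; case: (NC j) => _ [].
    by apply: ldomM => //; apply: ldom_cont; case: (NC j) => _ _ [].
  apply: ldomM => //; apply: ldomB => //.
  apply: ldom_sum => j.
  have br1 : ldom q0 (fun=> 1) (br j) by apply: ldom_cont; case: (bC j) => _ [].
  have bp1 : ldom q0 (fun=> 1) (bp j) by apply: ldom_cont; case: (bC j) => _ _ [].
  (* The primed coefficients are bounded because they differ from continuous ones by [O(W)] and [W]
     is bounded. *)
  have WB f f' : ldom q0 (fun=> 1) f -> ldom q0 W (fun q => f q - f' q) ->
      ldom q0 (fun=> 1) f'.
    move=> f1 ff; have := ldomB _ _ _ _ _ f1 (ldom_trans _ _ _ _ _ ff W1).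
    by apply: ldom_near; near=> q; ring.
  have t1 := ldom_cont _ _ _ (ct i); have m1 := ldom_cont _ _ _ (cm i).
  apply: ldom_mulB => //.
  - by apply: ldom_cont; case: (NC j).
  - by apply: ldomD; apply: ldomM => //; [exact: WB (tt i)|exact: WB (mm i)].
  - by apply: ldom_addB; apply: ldom_mulB => //; exact: ldom_reflB.
have WZ : ldom q0 (fun q => \sum_i `|z i q|) W.
  by apply: ldom_sum => j; apply: ldom_norm.
have /choice[L LP] : forall i, exists L, \forall q \near q0, `|l i q| <= L.
  move=> i; have [L _ lL] := l1 i; exists L.
  by apply: filterS lL => q; rewrite mulr1.
have /choice[K KP] : forall i, exists K, 0 <= K /\
    \forall q \near q0, `|d i q| <= K * \sum_j `|z j q|.
  by move=> i; have [K K0 dK] := ldom_trans _ _ _ _ _ (dW i) WZ; exists K.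
(* Sums of absolute values serve as constants independent of [i]. *)
have le_sum (x : 'I_n -> R) i : x i <= \sum_j `|x j|.
  by rewrite (bigD1 i)//= (le_trans (ler_norm _))// lerDl sumr_ge0.
have LP' : \forall q \near q0, forall i, `|l i q| <= \sum_j `|L j|.
  apply: (@filter_forall _ _ (fun i q => `|l i q| <= \sum_j `|L j|) (nbhs q0) _).
  by move=> i; apply: filterS (LP i) => q /le_trans; apply; exact: le_sum.
have KP' : \forall q \near q0, forall i,
    `|d i q| <= (\sum_j `|K j|) * \sum_j `|z j q|.
  apply: (@filter_forall _ _
    (fun i q => `|d i q| <= (\sum_j `|K j|) * \sum_j `|z j q|) (nbhs q0) _).
  move=> i; apply: filterS (KP i).2 => q /le_trans; apply.
  by rewrite ler_wpM2r ?sumr_ge0//; exact: le_sum.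
have zw0 : \forall q \near q0, forall i, z i q = 0.
  apply: (@transport_uniq _ _ _ _ _ (\sum_j `|L j|) (\sum_j `|K j|)).
  - near=> q => i.
    have Caq : forall i, C1_at (a i) (ar i) (ap i) q by near: q.
    have Cbq : forall i, C1_at (b i) (br i) (bp i) q by near: q.
    have CNq : forall i j, C1_at (N i j) (Nr i j) (Np i j) q by near: q.
    rewrite /z; apply: cvg_big => [|j _]; first exact: add_continuous.
    apply: cvgM; first by case: (CNq i j).
    by apply: cvgB; [case: (Caq j)|case: (Cbq j)].
  - apply: filterS ab0 => p abp i; rewrite /z big1// => j _.
    by rewrite /w abp subrr mulr0.
  - near=> q => i; exists (l i q), (d i q); split.
    + by move: i; near: q.
    + by move: i; near: q.
    + by move: i; near: q.
apply: (@filter_forall _ _ (fun i q => a i q = b i q) (nbhs q0) _) => i.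
have [C C0 wC] := wz i; near=> q.
apply/subr0_eq/normr0_eq0/eqP; rewrite eq_le normr_ge0 andbT.
have : `|w i q| <= C * \sum_i `|z i q| by near: q.
rewrite big1 ?mulr0// => j _; have -> : z j q = 0 by move: j; near: q.
by rewrite normr0.
Unshelve. all: by end_near. Qed.

(* [comp] alone would be the composition of functions. *)
Local Notation comp := Defs.comp.

(** * Riemann form of the given system *)

Section riemann_form.
Variable R : realType.
Implicit Types (r p : R) (u x y : 'cV[R]_4).

Lemma sum4 (V : nmodType) (f : 'I_4 -> V) :
  \sum_(j < 4) f j = f (inord 0) + f (inord 1) + f (inord 2) + f (inord 3).
Proof.
rewrite !big_ord_recr big_ord0 /= add0r.
by congr (f _ + f _ + f _ + f _); apply/val_inj; rewrite /= inordK.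
Qed.

Lemma forall4 (P : 'I_4 -> Prop) :
  P (inord 0) -> P (inord 1) -> P (inord 2) -> P (inord 3) -> forall i, P i.
Proof.
move=> P0 P1 P2 P3 i; rewrite -(inord_val i).
by case: i => -[|[|[|[|?]]]].
Qed.

Lemma mx4E (s : seq (seq R)) (i j : nat) : (i < 4)%N -> (j < 4)%N ->
  mx4 s (inord i) (inord j) = nth 0 (nth [::] s i) j.
Proof. by move=> i4 j4; rewrite mxE !inordK. Qed.

Definition riemann_N u : 'M[R]_4 :=
  mx4 [:: [:: 1; 0; 0; 0];
          [:: comp u 2 / 6; 1; 0; 0];
          [:: 5 * comp u 1; 0; 1; 0];
          [:: 0; comp u 1; comp u 2 / 3; 1]].

(* Row [i] of the Riemann form differentiates along
   [riemann_S u i * S + riemann_C u i * C], whose [d_r] and [d_phi] components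
   are [riemann_t] and [riemann_m]. *)
Definition riemann_S u (i : 'I_4) : R :=
  nth 0 [:: comp u 2 / 3; 1; 2 / 3 * comp u 2; 1] i.

Definition riemann_C u (i : 'I_4) : R :=
  nth 0 [:: 2 * comp u 1; 0; 2 * comp u 1; 0] i.

Definition riemann_t p u i : R :=
  riemann_S u i * sin (comp u 0 - p) + riemann_C u i * cos (comp u 0 - p).

Definition riemann_m r p u i : R :=
  r^-1 * (riemann_C u i * sin (comp u 0 - p) - riemann_S u i * cos (comp u 0 - p)).

Definition riemann_F u (i : 'I_4) : R :=
  nth 0 [:: - (3 * comp u 1 ^+ 2); comp u 1 ^+ 2 / 2;
            - (18 * comp u 1 ^+ 3) - 2 * comp u 1 * comp u 2 ^+ 2; 0] i.

(** Each row comes from a row vector whose products with [A] and [B] are [riemann_t] and [riemann_m]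
    times one and the same row of [riemann_N]. *)
Lemma riemann_formP r p u x y :
  Amat r p u *m x + Bmat r p u *m y + Cmat r p u *m u = 0 ->
  forall i, \sum_j riemann_N u i j *
    (riemann_t p u i * x j ord0 + riemann_m r p u i * y j ord0) = riemann_F u i.
Proof.
move=> E.
have e k : (k < 4)%N ->
    \sum_j Amat r p u (inord k) j * x j ord0 +
    \sum_j Bmat r p u (inord k) j * y j ord0 +
    \sum_j Cmat r p u (inord k) j * u j ord0 = 0.
  by move=> k4; have := congr1 (fun v : 'cV_4 => v (inord k) ord0) E; rewrite !mxE.
have := e 0 isT; have := e 1 isT; have := e 2 isT; have := e 3 isT.
rewrite !sum4 /Amat /Bmat /Cmat /=.
have cE (A : 'M[R]_4) (z : R) i j : (z *: A) i j = z * A i j by rewrite mxE.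
have oE (A : 'M[R]_4) i j : (- A) i j = - A i j by rewrite mxE.
(* An equality is reduced to writing [A - B] as a combination of the four scalar equations. *)
have lin (k0 k1 k2 k3 A B l0 l1 l2 l3 : R) :
    l0 = 0 -> l1 = 0 -> l2 = 0 -> l3 = 0 ->
    A - B = k0 * l0 + k1 * l1 + k2 * l2 + k3 * l3 -> A = B.
  by move=> -> -> -> -> AB; apply/subr0_eq; rewrite AB !mulr0 !addr0.
(* With the inverse of [r] made a variable, [field] does not ask for [r != 0]. *)
rewrite !cE !oE !mx4E//= /riemann_m; move: (r^-1) => ri e3 e2 e1 e0.
pose al := comp u 1.
apply: forall4; rewrite sum4 /riemann_N !mx4E//= /riemann_t
  /riemann_S /riemann_C /riemann_F !inordK//=.
(* The four multipliers in each call form the row vector that produces this row of the Riemann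
   form. *)
- by apply: (lin 1 (-1) 0 0 _ _ _ _ _ _ e0 e1 e2 e3); rewrite /al /comp; field.
- by apply: (lin (1/2) (1/2) 0 0 _ _ _ _ _ _ e0 e1 e2 e3); rewrite /al /comp; field.
- by apply: (lin (10 * al) (- 2 * al) (-1) (-1) _ _ _ _ _ _ e0 e1 e2 e3);
    rewrite /al /comp; field.
- by apply: (lin 0 (- al) (1/2) (-1/2) _ _ _ _ _ _ e0 e1 e2 e3);
    rewrite /al /comp; field.
Qed.

(** The determinant of [A] is the product of the four [riemann_t]. Exhibiting left null vectors
    avoids expanding it. *)
Lemma riemann_t_neq0 r p u i : \det (Amat r p u) != 0 -> riemann_t p u i != 0.
Proof.
move=> dA.
have ker (v : 'rV[R]_4) : (exists k, v ord0 k != 0) ->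
    (forall j, \sum_k v ord0 k * Amat r p u k j = 0) -> False.
  move=> [k vk] vA; move/det0P: dA; apply; exists v.
    by apply: contraNneq vk => ->; rewrite mxE.
  by apply/rowP => j; rewrite !mxE.
pose s := sin (comp u 0 - p); pose c := cos (comp u 0 - p).
pose al := comp u 1; pose H := comp u 2.
pose vec (l : seq R) : 'rV[R]_4 := \row_j nth 0 l j.
have vE l k : (k < 4)%N -> vec l ord0 (inord k) = nth 0 l k.
  by move=> k4; rewrite mxE inordK.
(* When one of the factors of [det A] vanishes, a left null vector is explicit. *)
have s0 : s != 0.
  apply/eqP => s0; apply: (ker (vec [:: 1; 1; 0; 0])).
    by exists (inord 0); rewrite vE//= oner_neq0.
  apply: forall4; rewrite sum4 !vE// /Amat !mx4E//= -/s -/c s0; ring.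
have t0 : H / 3 * s + 2 * al * c != 0.
  apply/eqP => t0; apply: (ker (vec [:: 1; -1; 0; 0])).
    by exists (inord 0); rewrite vE//= oner_neq0.
  by apply: forall4; rewrite sum4 !vE// /Amat !mx4E//= -/s -/c -/al -/H;
    [rewrite -[RHS]t0; ring|ring..].
have t2 : 2 / 3 * H * s + 2 * al * c != 0.
  apply/eqP => t2.
  (* The value of [k] cancels the first column. The second and fourth columns cancel for every [k],
     and the third gives minus the factor assumed to vanish. *)
  pose k := 10 * al ^+ 2 * c / (H / 3 * s + 2 * al * c).
  apply: (ker (vec [:: - k; k - 8 * al; 1; 1])).
    by exists (inord 2); rewrite vE//= oner_neq0.
  apply: forall4; rewrite sum4 !vE// /Amat !mx4E//= -/s -/c -/al -/H.
  - rewrite -[RHS](subrr (10 * al ^+ 2 * c)).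
    rewrite -[X in _ = _ - X](divfK t0 (10 * al ^+ 2 * c)) -/k; ring.
  - ring.
  - by rewrite -[RHS]oppr0 -[in RHS]t2; field.
  - ring.
apply: (forall4 (fun i => riemann_t p u i != 0));
  rewrite /riemann_t /riemann_S /riemann_C !inordK//= -/s -/c -/al -/H.
- by rewrite mul1r mul0r addr0.
- by rewrite mul1r mul0r addr0.
Qed.

End riemann_form.

Arguments riemann_N {R}.
Arguments riemann_S {R}.
Arguments riemann_C {R}.
Arguments riemann_t {R}.
Arguments riemann_m {R}.
Arguments riemann_F {R}.

(** * Continuity and Lipschitz dependence of the Riemann coefficients *)

Lemma sin_lip (R : realType) (x y : R) : `|sin x - sin y| <= `|x - y|.
Proof.
have [z _ e] := @MVT_dist R sin cos y (x - y) (fun z _ => is_derive_sin z).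
have {e} -> : sin x - sin y = cos z * (x - y) by rewrite -e (addrC y) subrK.
rewrite normrM ler_piMl//.
by rewrite ler_norml cos_geN1 cos_le1.
Qed.

Lemma cos_lip (R : realType) (x y : R) : `|cos x - cos y| <= `|x - y|.
Proof.
have [z _ e] := @MVT_dist R cos (fun z => - sin z) y (x - y)
  (fun z _ => is_derive_cos z).
have {e} -> : cos x - cos y = - sin z * (x - y) by rewrite -e (addrC y) subrK.
rewrite normrM normrN ler_piMl//.
by rewrite ler_norml sin_geN1 sin_le1.
Qed.

(** Openness of [W] turns continuity within [W] into continuity at the point; orders 0 and 1 of
    smoothness suffice. *)
Lemma smooth_on_C1 (R : realType) (W : set (R * R)) (f : R -> R -> R) (q : R * R) :
  open W -> smooth_on W f -> W q ->
  C1_at (fun z => f z.1 z.2) (fun z => partial_r f z.1 z.2)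
    (fun z => partial_phi f z.1 z.2) q.
Proof.
move=> oW sf Wq.
have cW g : {within W, continuous g} -> {for q, continuous (g : R * R -> R)}.
  by rewrite continuous_open_subspace// => /(_ q); apply; rewrite inE.
have [/(_ q.1 q.2)] := sf 1%N; rewrite -surjective_pairing => /(_ Wq)[dr dp] [cr cp].
have := sf 0%N => /= c0; split; first exact: cW.
  by split; [apply: DeriveDef => //; rewrite /partial_r derive1E|exact: cW].
by split; [apply: DeriveDef => //; rewrite /partial_phi derive1E|exact: cW].
Qed.

Lemma C1_at_affine (R : realType) (e k : R) (f fr fp : R * R -> R) (q : R * R) :
  C1_at f fr fp q ->
  C1_at (fun q => e + k * f q) (fun q => k * fr q) (fun q => k * fp q) q.
Proof.
have df (g : R -> R) (x d : R) : is_derive x 1 g d ->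
    is_derive x 1 (fun t => e + k * g t) (k * d).
  by move=> gd; apply: is_derive_eq; rewrite add0r mul1r.
move=> [cf [dr cr] [dp cp]]; split.
- by apply: cvgD; [exact: cvg_cst|apply: cvgMr; exact: cf].
- by split; [exact: df|apply: cvgMr; exact: cr].
- by split; [exact: df|apply: cvgMr; exact: cp].
Qed.

(** Regularity and Lipschitz estimates for the matrix thus reduce to those of a single component of
    the solution. *)
Lemma riemann_N_affine (R : realType) (i j : 'I_4) : exists k e : R, exists l : nat,
  forall w : 'cV[R]_4, riemann_N w i j = e + k * comp w l.
Proof.
move: i; apply: forall4; move: j; apply: forall4;
  by [exists 0, 0, 0%N => w; rewrite mx4E//=; ring
     |exists 0, 1, 0%N => w; rewrite mx4E//=; ring
     |exists 6^-1, 0, 2%N => w; rewrite mx4E//=; ring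
     |exists 5, 0, 1%N => w; rewrite mx4E//=; ring
     |exists 1, 0, 1%N => w; rewrite mx4E//=; ring
     |exists 3^-1, 0, 2%N => w; rewrite mx4E//=; ring].
Qed.

Section continuous_riemann.
Variables (R : realType) (q0 : R * R) (u : R * R -> 'cV[R]_4).
Hypothesis cu : forall i : nat, {for q0, continuous (fun q => comp (u q) i)}.

Lemma continuous_angle (f : R -> R) :
  continuous f -> {for q0, continuous (fun q => f (comp (u q) 0 - q.2))}.
Proof.
move=> cf; apply: (@continuous_cvg _ _ _ _ _ _ f); first exact: cf.
by apply: cvgB; [exact: cu|exact: cvg_snd].
Qed.

Lemma continuous_riemann_S i :
  {for q0, continuous (fun q => riemann_S (u q) i)}.
Proof.
move: i; apply: forall4; rewrite /riemann_S inordK//=;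
  [apply: cvgMl|exact: cvg_cst|apply: cvgMr|exact: cvg_cst]; exact: cu.
Qed.

Lemma continuous_riemann_C i :
  {for q0, continuous (fun q => riemann_C (u q) i)}.
Proof.
move: i; apply: forall4; rewrite /riemann_C inordK//=;
  [apply: cvgMr; exact: cu|exact: cvg_cst|apply: cvgMr; exact: cu|exact: cvg_cst].
Qed.

Lemma continuous_riemann_t i :
  {for q0, continuous (fun q => riemann_t q.2 (u q) i)}.
Proof.
apply: cvgD; apply: cvgM.
- exact: continuous_riemann_S.
- by apply: continuous_angle; exact: continuous_sin.
- exact: continuous_riemann_C.
- by apply: continuous_angle; exact: continuous_cos.
Qed.

Lemma continuous_riemann_m i : q0.1 != 0 ->
  {for q0, continuous (fun q => riemann_m q.1 q.2 (u q) i)}.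
Proof.
move=> q00; apply: cvgM; first by apply: cvgV => //; exact: cvg_fst.
apply: cvgB; apply: cvgM.
- exact: continuous_riemann_C.
- by apply: continuous_angle; exact: continuous_sin.
- exact: continuous_riemann_S.
- by apply: continuous_angle; exact: continuous_cos.
Qed.

End continuous_riemann.

Section ldom_riemann.
Variables (R : realType) (q0 : R * R) (u v : R * R -> 'cV[R]_4).
Hypothesis cu : forall i : nat, {for q0, continuous (fun q => comp (u q) i)}.
Hypothesis cv : forall i : nat, {for q0, continuous (fun q => comp (v q) i)}.
Variable M : R * R -> R.
Hypothesis uv : forall i : nat, ldom q0 M (fun q => comp (u q) i - comp (v q) i).

(** Both angles are taken at the same [phi], so they differ exactly by the difference of the two
    [theta]. *)
Lemma ldom_angle (f : R -> R) : (forall x y, `|f x - f y| <= `|x - y|) ->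
  ldom q0 M (fun q => f (comp (u q) 0 - q.2) - f (comp (v q) 0 - q.2)).
Proof.
move=> flip; have [K K0 uvK] := uv 0%N; exists K => //.
apply: filterS uvK => q; apply: le_trans; apply: le_trans (flip _ _) _.
by rewrite opprB addrA subrK.
Qed.

Lemma ldom_riemann_S i :
  ldom q0 M (fun q => riemann_S (u q) i - riemann_S (v q) i).
Proof.
have cst := ldom_cst R q0.
have u1 k := ldom_cont R q0 _ (cu k); have v1 k := ldom_cont R q0 _ (cv k).
move: i; apply: forall4; rewrite /riemann_S inordK//=;
  by [exact: ldom_reflB|apply: ldom_mulB => //; exact: ldom_reflB].
Qed.

Lemma ldom_riemann_C i :
  ldom q0 M (fun q => riemann_C (u q) i - riemann_C (v q) i).
Proof.
have cst := ldom_cst R q0.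
have u1 k := ldom_cont R q0 _ (cu k); have v1 k := ldom_cont R q0 _ (cv k).
move: i; apply: forall4; rewrite /riemann_C inordK//=;
  by [exact: ldom_reflB|apply: ldom_mulB => //; exact: ldom_reflB].
Qed.

Lemma ldom_riemann_N i j :
  ldom q0 M (fun q => riemann_N (u q) i j - riemann_N (v q) i j).
Proof.
have [k [e [l El]]] := riemann_N_affine R i j.
apply: (ldom_near _ _ _ _ (fun q => k * (comp (u q) l - comp (v q) l))).
  by near=> q; rewrite !El; ring.
by apply: ldomM => //; exact: ldom_cst.
Unshelve. all: by end_near. Qed.

Lemma ldom_riemann_F i :
  ldom q0 M (fun q => riemann_F (u q) i - riemann_F (v q) i).
Proof.
have cst := ldom_cst R q0.
have u1 k := ldom_cont R q0 _ (cu k); have v1 k := ldom_cont R q0 _ (cv k).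
have v2 k : ldom q0 (fun=> 1) (fun q => comp (v q) k ^+ 2).
  exact: (ldomM _ _ _ _ _ (v1 k) (v1 k)).
have u2 k : ldom q0 (fun=> 1) (fun q => comp (u q) k ^+ 2).
  exact: (ldomM _ _ _ _ _ (u1 k) (u1 k)).
have uv2 k : ldom q0 M (fun q => comp (u q) k ^+ 2 - comp (v q) k ^+ 2).
  exact: (ldom_mulB _ _ _ _ _ _ _ (u1 k) (v1 k) (uv k) (uv k)).
have uv3 k : ldom q0 M (fun q => comp (u q) k ^+ 3 - comp (v q) k ^+ 3).
  exact: (ldom_mulB _ _ _ _ _ _ _ (u1 k) (v2 k) (uv k) (uv2 k)).
have v3 k : ldom q0 (fun=> 1) (fun q => comp (v q) k ^+ 3).
  exact: (ldomM _ _ _ _ _ (v1 k) (v2 k)).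
have rf (k : R) := ldom_reflB R q0 M (fun=> k).
move: i; apply: forall4; rewrite /riemann_F inordK//=.
- by apply: ldom_oppB; apply: ldom_mulB.
- by apply: ldom_mulB.
- apply: ldom_addB; apply: ldom_oppB; apply: ldom_mulB => //.
    exact: ldomM.
  exact: ldom_mulB.
Qed.

Lemma ldom_riemann_t i :
  ldom q0 M (fun q => riemann_t q.2 (u q) i - riemann_t q.2 (v q) i).
Proof.
apply: ldom_addB; apply: ldom_mulB.
- by apply: ldom_cont; exact: continuous_riemann_S.
- by apply: ldom_cont; apply: continuous_angle => //; exact: continuous_sin.
- exact: ldom_riemann_S.
- by apply: ldom_angle; exact: sin_lip.
- by apply: ldom_cont; exact: continuous_riemann_C.
- by apply: ldom_cont; apply: continuous_angle => //; exact: continuous_cos.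
- exact: ldom_riemann_C.
- by apply: ldom_angle; exact: cos_lip.
Qed.

Lemma ldom_riemann_m i : q0.1 != 0 -> ldom q0 M
  (fun q => riemann_m q.1 q.2 (u q) i - riemann_m q.1 q.2 (v q) i).
Proof.
move=> q00.
have sv : ldom q0 (fun=> 1) (fun q => sin (comp (v q) 0 - q.2)).
  by apply: ldom_cont; apply: continuous_angle => //; exact: continuous_sin.
have cv' : ldom q0 (fun=> 1) (fun q => cos (comp (v q) 0 - q.2)).
  by apply: ldom_cont; apply: continuous_angle => //; exact: continuous_cos.
have S1 w (cw : forall i : nat, {for q0, continuous (fun q => comp (w q) i)}) :=
  ldom_cont _ _ _ (continuous_riemann_S _ _ w cw i).
have C1 w (cw : forall i : nat, {for q0, continuous (fun q => comp (w q) i)}) :=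
  ldom_cont _ _ _ (continuous_riemann_C _ _ w cw i).
apply: ldom_mulB.
- by apply: ldom_cont; apply: cvgV => //; exact: cvg_fst.
- by apply: ldomB; apply: ldomM => //; [exact: C1|exact: S1].
- exact: ldom_reflB.
apply: ldom_addB; [|apply: ldom_oppB]; apply: ldom_mulB => //.
- exact: C1.
- exact: ldom_riemann_C.
- by apply: ldom_angle; exact: sin_lip.
- exact: S1.
- exact: ldom_riemann_S.
- by apply: ldom_angle; exact: cos_lip.
Qed.

End ldom_riemann.

(** Forward substitution: the matrix is lower unitriangular with entries continuous at [q0], so each
    [w_j] is [z_j] minus bounded multiples of earlier components. *)
Lemma ldom_riemann_inv (R : realType) (q0 : R * R) (u : R * R -> 'cV[R]_4)
    (w : 'I_4 -> R * R -> R) :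
  let z i q := \sum_j riemann_N (u q) i j * w j q in
  (forall i : nat, {for q0, continuous (fun q => comp (u q) i)}) ->
  forall j, ldom q0 (fun q => \sum_i `|z i q|) (w j).
Proof.
move=> z cu; set Z := fun q => _.
have zZ i : ldom q0 Z (z i).
  exists 1 => //; near=> q; rewrite mul1r /Z (bigD1 i)//= lerDl.
  exact: sumr_ge0.
have ku k l : ldom q0 (fun=> 1) (fun q => k * comp (u q) l).
  by apply: ldomM; [exact: ldom_cst|apply: ldom_cont; exact: cu].
have w0 : ldom q0 Z (w (inord 0)).
  apply: ldom_near (zZ (inord 0)); near=> q.
  by rewrite /z sum4 !mx4E//=; ring.
have w1 : ldom q0 Z (w (inord 1)).
  apply: ldom_near (ldomB _ _ _ _ _ (zZ (inord 1))
    (ldomM _ _ _ _ _ (ku (1/6) 2%N) w0)); near=> q.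
  by rewrite /z sum4 !mx4E//=; ring.
have w2 : ldom q0 Z (w (inord 2)).
  apply: ldom_near (ldomB _ _ _ _ _ (zZ (inord 2))
    (ldomM _ _ _ _ _ (ku 5 1%N) w0)); near=> q.
  by rewrite /z sum4 !mx4E//=; ring.
apply: forall4 => //.
apply: ldom_near (ldomB _ _ _ _ _ (ldomB _ _ _ _ _ (zZ (inord 3))
  (ldomM _ _ _ _ _ (ku 1 1%N) w1)) (ldomM _ _ _ _ _ (ku (1/3) 2%N) w2)).
by near=> q; rewrite /z sum4 !mx4E//=; ring.
Unshelve. all: by end_near. Qed.

Lemma C1_at_riemann_N (R : realType) (W : set (R * R)) (u ur up : R * R -> 'cV[R]_4) :
  (forall q, W q -> forall l : nat, C1_at (fun q => comp (u q) l)
     (fun q => comp (ur q) l) (fun q => comp (up q) l) q) ->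
  exists Nr Np : 'I_4 -> 'I_4 -> R * R -> R, forall q, W q ->
    forall i j, C1_at (fun q => riemann_N (u q) i j) (Nr i j) (Np i j) q.
Proof.
move=> Cu.
have H (ij : 'I_4 * 'I_4) : exists g : (R * R -> R) * (R * R -> R),
    forall q, W q ->
    C1_at (fun q => riemann_N (u q) ij.1 ij.2) g.1 g.2 q.
  have [k [e [l El]]] := riemann_N_affine R ij.1 ij.2.
  exists (fun q => k * comp (ur q) l, fun q => k * comp (up q) l) => q Wq.
  rewrite (_ : (fun q => _) = (fun q => e + k * comp (u q) l)).
    exact: C1_at_affine (Cu q Wq l).
  by apply/funext => x; rewrite El.
have [g gP] := choice H.
by exists (fun i j => (g (i, j)).1), (fun i j => (g (i, j)).2) => q Wq i j;
  exact: (gP (i, j)).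
Qed.

(** * Uniqueness at each point of the curve, and gluing *)

Theorem theorem3p3 (R : realType) (c : R) (U V : R -> R -> 'cV[R]_4)
    (W : set (R * R)) :
  0 < c ->
  open W -> (forall z, W z -> 0 < z.1) -> (forall phi, W (c, phi)) ->
  smoothV W U -> smoothV W V -> solves W U -> solves W V ->
  (forall phi, \det (Amat c phi (U c phi)) != 0) ->
  (forall phi, U c phi = V c phi) ->
  exists W' : set (R * R), open W' /\ (forall phi, W' (c, phi)) /\
    (forall r phi, W' (r, phi) -> U r phi = V r phi).
Proof.
move=> c0 oW _ Wc sU sV eU eV dA UV.
(* The interior of the coincidence set is the required neighborhood; its width need not be uniform
   in [phi]. *)
suff uniq (p0 : R) : \forall q \near (c, p0), U q.1 q.2 = V q.1 q.2.
  exists [set q | U q.1 q.2 = V q.1 q.2]°; split; first exact: open_interior.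
  by split=> [phi|r phi /interior_subset//]; exact: uniq.
have nW : \forall q \near (c, p0), W q by apply: open_nbhs_nbhs; split.
pose u q := U q.1 q.2; pose v q := V q.1 q.2.
pose ur q := dU_r U q.1 q.2; pose up q := dU_phi U q.1 q.2.
pose vr q := dU_r V q.1 q.2; pose vp q := dU_phi V q.1 q.2.
have CE (X : R -> R -> 'cV[R]_4) i q : smoothV W X -> W q ->
    C1_at (fun q => X q.1 q.2 i ord0) (fun q => dU_r X q.1 q.2 i ord0)
      (fun q => dU_phi X q.1 q.2 i ord0) q.
  move=> sX Wq; have := smooth_on_C1 _ _ _ _ oW (sX i) Wq.
  by congr C1_at; apply/funext => x; rewrite mxE.
have [Nr [Np CN]] := C1_at_riemann_N R W u ur up
  (fun q Wq l => CE U (inord l) q sU Wq).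
have cu (i : nat) : {for (c, p0), continuous (fun q => comp (u q) i)}.
  by have [] := CE U (inord i) _ sU (Wc p0).
have cv (i : nat) : {for (c, p0), continuous (fun q => comp (v q) i)}.
  by have [] := CE V (inord i) _ sV (Wc p0).
pose a j q := u q j ord0; pose b j q := v q j ord0.
have ldom_uv (i : nat) : ldom (c, p0) (fun q => \sum_j `|a j q - b j q|)
    (fun q => comp (u q) i - comp (v q) i).
  exists 1 => //; near=> q; rewrite mul1r (bigD1 (inord i))//= lerDl.
  exact: sumr_ge0.
have c_neq0 : (c, p0).1 != 0 by rewrite gt_eqF.
suff : \forall q \near (c, p0), forall j, a j q = b j q.
  by apply: filterS => q ab; apply/colP => j; exact: ab.
apply: (@riemann_uniq R 4 c p0 a (fun j q => ur q j ord0)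
  (fun j q => up q j ord0) b (fun j q => vr q j ord0) (fun j q => vp q j ord0)
  (fun i j q => riemann_N (u q) i j) Nr Np
  (fun i j q => riemann_N (v q) i j)
  (fun i q => riemann_t q.2 (u q) i) (fun i q => riemann_t q.2 (v q) i)
  (fun i q => riemann_m q.1 q.2 (u q) i)
  (fun i q => riemann_m q.1 q.2 (v q) i)
  (fun i q => riemann_F (u q) i) (fun i q => riemann_F (v q) i)).
- by apply: filterS nW => q Wq i; exact: CE.
- by apply: filterS nW => q Wq i; exact: CE.
- by apply: filterS nW => q Wq i j; exact: CN.
- by move=> i; exact: continuous_riemann_t.
- by move=> i; exact: continuous_riemann_m.
- by move=> i; apply: riemann_t_neq0; exact: dA.
- by move=> i; exact: ldom_riemann_t.
- by move=> i; exact: ldom_riemann_m.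
- by move=> i; exact: ldom_riemann_F.
- by move=> i j; exact: ldom_riemann_N.
- exact: ldom_riemann_inv.
- by apply: filterS nW => -[r p] Wq i; exact: riemann_formP (eU _ _ Wq) i.
- by apply: filterS nW => -[r p] Wq i; exact: riemann_formP (eV _ _ Wq) i.
- by near=> p => i; rewrite /a /b /u /v /= UV.
Unshelve. all: by end_near. Qed.
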